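(* Let $G$ be a simply connected complex almost Abelian Lie group with Lie algebra $\mathfrak{a}(\aleph)$, let $J=J(\aleph)$, let $\exp_G:\mathfrak{a}(\aleph)\to G$ be its exponential map, and let $T_\aleph := \{z\in\mathbb{C} : e^{zJ}=\mathbb{1}\}$. Then the center of $G$ is $$Z(G) = \exp_G[Z(\mathfrak{a}(\aleph))]\times T_\aleph = \exp_G[Z(\mathfrak{a}(\aleph))\times T_\aleph] = \{[u,s]\in \mathbb{C}^d\rtimes\mathbb{C} : u\in\ker J,\ e^{sJ}=\mathbb{1}\}.$$ Moreover, the preimage under $\exp_G$ of the identity component $Z(G)_0$ of the center is $$\exp_G^{-1}[Z(G)_0] = Z(\mathfrak{a}(\aleph)).$$
   Context: A finitely-supported multiplicity function is a function $\aleph:\mathbb{C}\times\mathbb{N}\to\{0,1,2,\dots\}$ (with $\mathbb{N}=\{1,2,\dots\}$) that is nonzero at only finitely many pairs. Its Jordan matrix $J(\aleph)$ is the $d\times d$ block-diagonal matrix containing, for each $(\lambda,n)$, exactly $\aleph(\lambda,n)$ copies of the $n\times n$ Jordan block with eigenvalue $\lambda$. The Lie algebra $\mathfrak{a}(\aleph)$ is $\mathbb{C}^d\oplus\mathbb{C}$ with bracket $[(v,t),(u,s)] = (tJu-sJv,0)$; it is almost Abelian (non-Abelian with a codimension 1 Abelian subalgebra), so $J\neq 0$. Its center is $Z(\mathfrak{a}(\aleph)) = \ker J \subseteq\mathbb{C}^d$ (i.e. $\ker J\times\{0\}$). The simply connected group is $G=\mathbb{C}^d\rtimes\mathbb{C}$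 with elements $[v,t]$, product $[v,t][u,s]=[v+e^{tJ}u,\,t+s]$, and $\exp_G(v,t)=\left[\sum_{n\ge1}\frac{(tJ)^{n-1}}{n!}v,\ t\right]$. In the product notation, $\exp_G[Z(\mathfrak{a}(\aleph))]\times T_\aleph$ means the set of elements $[u,s]$ with $[u,0]\in\exp_G[Z(\mathfrak{a}(\aleph))]$ and $s\in T_\aleph$, and $Z(\mathfrak{a}(\aleph))\times T_\aleph$ means the set of $(u,s)\in\mathbb{C}^d\oplus\mathbb{C}$ with $u\in\ker J$ and $s\in T_\aleph$. *)

(* Defs.v *)
From HB Require Import structures.
From mathcomp Require Import all_boot all_order all_algebra.
From mathcomp Require Import finmap.
From mathcomp Require Import complex.
From mathcomp Require Import all_classical all_reals all_analysis.

Set Implicit Arguments.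
Unset Strict Implicit.
Unset Printing Implicit Defensive.

Import Order.TTheory GRing.Theory Num.Theory.
Import numFieldNormedType.Exports.

Local Open Scope classical_set_scope.
Local Open Scope ring_scope.

(* Going through numClosedFieldType gives R[i] the topology induced by its
   complex modulus. *)
Definition Cplx (R : realType) : numClosedFieldType := R[i].

Definition multiplicity (R : realType) : Type :=
  {fsfun Cplx R * {n : nat | (0 < n)%N} -> nat with 0%N}.

Section JordanMatrix.
Variable R : realType.
Implicit Type aleph : multiplicity R.

Definition jordan_block (lambda : Cplx R) (n : nat) : 'M[Cplx R]_n :=
  \matrix_(i, j) (if i == j then lambda else (i.+1 == j :> nat)%:R).

(* Each (lambda, n) is listed aleph (lambda, n) times; the order of the blocks
   is that of the canonical enumeration of the support. *)
Definition jordan_blocks aleph : seq (Cplx R * {n : nat | (0 < n)%N}) :=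
  flatten [seq nseq (aleph p) p | p <- enum_fset (finsupp aleph)].

Definition jordan_nth aleph (i : 'I_(size (jordan_blocks aleph))) :=
  tnth (in_tuple (jordan_blocks aleph)) i.

Definition jordan_dim aleph : nat :=
  (\sum_(i < size (jordan_blocks aleph)) val (jordan_nth i).2)%N.

Definition jordan_mx aleph : 'M[Cplx R]_(jordan_dim aleph) :=
  \mxdiag_(i < size (jordan_blocks aleph))
    jordan_block (jordan_nth i).1 (val (jordan_nth i).2).

End JordanMatrix.

Section AlmostAbelian.
Variables (R : realType) (d : nat).
Local Notation C := (Cplx R).
Local Notation V := ('cV[C]_d * C)%type.
Implicit Type J : 'M[C]_d.

Definition mexp (A : 'M[C]_d) : 'M[C]_d :=
  limn (series (fun n => (n`!%:R)^-1 *: A ^+ n)).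

(* The carrier V = C^d (+) C is shared by the Lie algebra and by the group
   C^d ><| C; its topology is the product topology. *)
Definition lie_bracket J (x y : V) : V :=
  (x.2 *: (J *m y.1) - y.2 *: (J *m x.1), 0).

Definition lie_center J : set V :=
  [set x | forall y, lie_bracket J x y = 0].

(* The third condition entails that A is closed under the bracket. *)
Definition almost_abelian J : Prop :=
  (exists x y, lie_bracket J x y != 0) /\
  (exists A : {vspace V},
    (\dim A).+1 = \dim {: V} /\
    (forall x y, x \in A -> y \in A -> lie_bracket J x y = 0)).

Definition grp_mul J (g h : V) : V :=
  (g.1 + mexp (g.2 *: J) *m h.1, g.2 + h.2).

Definition grp_one : V := (0, 0).

Definition grp_center J : set V :=
  [set g | forall h, grp_mul J g h = grp_mul J h g].

Definition grp_center0 J : set V :=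
  connected_component (grp_center J) grp_one.

(* sum_{n >= 1} (tJ)^(n-1) / n!, reindexed from 0. *)
Definition grp_exp J (x : V) : V :=
  (limn (series (fun n => (n.+1`!%:R)^-1 *: ((x.2 *: J) ^+ n *m x.1))), x.2).

Definition exp_period J : set C := [set z | mexp (z *: J) = 1%:M].

End AlmostAbelian.

(* Main.v *)
(* The centre of G is computed by testing commutation against (0, z) and (v, 0):
   [u, s] is central iff e^(zJ) u = u for all z and e^(sJ) = 1.  Since
   e^(zJ) u = u + z J u + O(z^2), the fixed-point equation forces J u = 0 as soon
   as it holds for arbitrarily small z <> 0.  The same estimate, applied to a
   vector u with J u <> 0, shows that 0 is isolated among the periods of
   z |-> e^(zJ), so the identity component of the centre is ker J x {0}. *)
Require Import Defs.
From mathcomp Require Import all_boot all_order all_algebra.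
From mathcomp Require Import complex ring.
From mathcomp Require Import all_classical all_reals all_analysis.

Set Implicit Arguments.
Unset Strict Implicit.

Import Order.TTheory GRing.Theory Num.Theory numFieldNormedType.Exports.
Local Open Scope classical_set_scope.
Local Open Scope ring_scope.

(** * Convergence of complex series *)

Lemma real_complex_continuous (R : realType) :
  continuous (fun x : R => (x%:C)%C : Cplx R).
Proof.
move=> x; apply/cvgrPdist_lt => e e0.
have eE : e = ((complex.Re e)%:C)%C by rewrite RRe_real// gtr0_real.
(* A positive element of [Cplx R] is real, so the estimate descends to [R]. *)
have e'0 : 0 < complex.Re e by rewrite -ltcR -eE.
near=> y.
rewrite -[X in `|X|](rmorphB (real_complex R)) normc_def/= expr0n addr0 sqrtr_sqr.
rewrite eE ltcR.
near: y; exact: cvgr_dist_lt.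
Unshelve. all: by end_near. Qed.

(** The modulus dominates the real and imaginary parts, so the real comparison test applies to each
    of them. *)
Lemma cvgn_series_complex (R : realType) (u : (Cplx R)^nat) (v : R^nat) :
    (forall n, `|u n| <= ((v n)%:C)%C) -> cvgn (series v) ->
  cvgn (series u).
Proof.
move=> uv cv.
have v0 n : 0 <= v n by rewrite -ler0c; exact: le_trans (normr_ge0 _) (uv n).
pose re n := complex.Re (u n); pose im n := complex.Im (u n).
have cvg_dom (f : R^nat) : (forall n, `|f n| <= v n) -> cvgn (series f).
  by move=> fv; apply: normed_cvg; apply: series_le_cvg v0 fv cv => n.
have cre : cvgn (series re).
  by apply: cvg_dom => n; rewrite -lecR; exact: le_trans (normc_ge_Re _) (uv n).
have cim : cvgn (series im).
  apply: cvg_dom => n; rewrite -lecR -normrN -ReiNIm.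
  apply: le_trans (normc_ge_Re _) _.
  by rewrite normrM [X in _ * X]normc_def/= expr0n expr1n add0r sqrtr1 mulr1.
have -> : series u = fun n =>
    ((series re n)%:C)%C + 'i%C * ((series im n)%:C)%C :> Cplx R.
  apply/funext => n; rewrite /series/= [LHS](eq_bigr _ (fun k _ => complexE (u k))).
  by rewrite big_split/= -mulr_sumr !(rmorph_sum (real_complex R)).
apply: is_cvgD; last apply: is_cvgMl_tmp.
  apply/cvg_ex; exists ((limn (series re))%:C)%C.
  exact: cvg_comp cre (@real_complex_continuous R _).
apply/cvg_ex; exists ((limn (series im))%:C)%C.
exact: cvg_comp cim (@real_complex_continuous R _).
Qed.

Lemma cvgn_exp_series (R : realType) (a : (Cplx R)^nat) (K : Cplx R) : 0 <= K ->
  (forall n, `|a n| <= K ^+ n) -> cvgn (series (fun n => (n`!%:R)^-1 * a n)).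
Proof.
move=> K0 aK; have KE : K = ((complex.Re K)%:C)%C by rewrite RRe_real// ger0_real.
apply: (@cvgn_series_complex _ _ (exp_coeff (complex.Re K))); last first.
  exact: is_cvg_series_exp_coeff.
move=> n; rewrite /exp_coeff/= mulrC normrM normfV normr_nat.
rewrite (rmorphM (real_complex R)) fmorphV rmorphXn rmorph_nat/= -KE.
by rewrite ler_wpM2r// invr_ge0 ler0n.
Qed.

(** * Matrix limits and entrywise bounds *)

(** Separation is inherited from the entries, which are continuous; it makes [limn] of a convergent
    matrix sequence equal to its limit. *)
Lemma mx_hausdorff (K : numFieldType) m n : hausdorff_space 'M[K]_(m, n).
Proof.
move=> A B AB; apply/matrixP => i j; apply: (@norm_hausdorff K K) => P Q PA QB.
have [M [PM QM]] := AB _ _ (coord_continuous PA) (coord_continuous QB).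
by exists (M i j).
Qed.

Lemma cvg_mx (K : numFieldType) m n (T : Type) (F : set_system T) (FF : Filter F)
    (u : T -> 'M[K]_(m, n)) (A : 'M[K]_(m, n)) :
  (forall i j, u x i j @[x --> F] --> A i j) -> u @ F --> A.
Proof.
move=> uA S [P PA PS]; apply: (filterS PS).
have : \forall x \near F, forall ij : 'I_m * 'I_n, P ij.1 ij.2 (u x ij.1 ij.2).
  by apply: filter_forall => -[i j]; apply: uA; exact: PA.
by apply: filterS => x h i j; exact: (h (i, j)).
Qed.

(** The entrywise l1 norm, chosen because its powers bound the entries of matrix powers with no
    dimension factor. *)
Definition mx_norm1 (K : numFieldType) m n (A : 'M[K]_(m, n)) : K :=
  \sum_i \sum_j `|A i j|.

Lemma mx_norm1_ge0 (K : numFieldType) m n (A : 'M[K]_(m, n)) : 0 <= mx_norm1 A.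
Proof. by apply: sumr_ge0 => i _; apply: sumr_ge0. Qed.

Lemma mulmx_entry_le (K : numFieldType) m n p
    (A : 'M[K]_(m, n)) (B : 'M[K]_(n, p)) c :
  (forall i j, `|A i j| <= c) -> forall i j, `|(A *m B) i j| <= c * mx_norm1 B.
Proof.
move=> Ac i j; rewrite mxE; apply: (le_trans (ler_norm_sum _ _ _)).
rewrite mulr_sumr; apply: ler_sum => k _; rewrite normrM; apply: ler_pM => //.
by rewrite (bigD1 j)//= lerDl sumr_ge0.
Qed.

Lemma expmx_entry_le (K : numFieldType) n (A : 'M[K]_n) k i j :
  `|(A ^+ k) i j| <= mx_norm1 A ^+ k.
Proof.
elim: k i j => [|k IH] i j.
  by rewrite !expr0 mxE; case: eqP; rewrite ?normr1 ?normr0 ?lexx ?ler01.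
by rewrite !exprSr; exact: mulmx_entry_le.
Qed.

(** * Second-order remainder of exponential series *)

Lemma geometric_sum_le2 (K : numFieldType) (q : K) n : 0 <= q -> q <= 2^-1 ->
  \sum_(0 <= k < n) q ^+ k <= 2.
Proof.
move=> q0 q2.
(* The extra term makes the induction close: q^n + 2 q^(n+1) <= 2 q^n because 2 q <= 1. *)
suff : \sum_(0 <= k < n) q ^+ k + 2 * q ^+ n <= 2.
  by apply: le_trans; rewrite lerDl mulr_ge0// exprn_ge0.
elim: n => [|n IH]; first by rewrite big_nil expr0 mulr1 add0r.
rewrite big_nat_recr//=; apply: le_trans IH; rewrite -addrA lerD2l.
rewrite [leRHS]mulr_natl mulr2n lerD2l exprS mulrA ler_piMl ?exprn_ge0//.
by rewrite -ler_pdivlMl// mulr1.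
Qed.

(** Past the first two terms, bounding 1/k! by 1 leaves U q^2 times a geometric sum, which is at
    most 2. *)
Lemma exp_series_quadratic (K : numFieldType) (a : K^nat) (U q l : K) :
    0 <= q -> q <= 2^-1 -> (forall k, `|a k| <= U * q ^+ k) ->
    series (fun k => (k`!%:R)^-1 * a k) @ \oo --> l ->
  `|l - (a 0%N + a 1%N)| <= 2 * U * q ^+ 2.
Proof.
move=> q0 q2 aU al; apply/ler_addgt0Pr => e e0.
have U0 : 0 <= U by have := aU 0%N; rewrite expr0 mulr1; exact: le_trans.
have : \forall n \near \oo,
    (2 <= n)%N /\ `|l - series (fun k => (k`!%:R)^-1 * a k) n| < e.
  near=> n; split; near: n; first exact: nbhs_infty_ge.
  by move/cvgrPdist_lt : al; exact.
case/filter_ex => -[|[|n]] [//= _ ln].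
apply: (le_trans (ler_distD (series (fun k => (k`!%:R)^-1 * a k) n.+2) _ _)).
rewrite addrC lerD ?(ltW ln)//.
rewrite /series/= !big_nat_recl// !fact0 (_ : 1`! = 1)%N// invr1 !mul1r addrA.
rewrite [X in `|X|]addrAC subrr add0r.
apply: (le_trans (ler_norm_sum _ _ _)).
apply: (@le_trans _ _ (\sum_(0 <= k < n) U * q ^+ 2 * q ^+ k)).
  apply: ler_sum => k _; rewrite normrM -mulrA -exprD.
  rewrite -[leRHS]mul1r ler_pM//.
  by rewrite ger0_norm ?invf_le1 ?ler1n ?invr_ge0 ?ler0n ?ltr0n ?fact_gt0.
rewrite -mulr_sumr mulrC -[leRHS]mulrA ler_wpM2r ?geometric_sum_le2//.
by rewrite mulr_ge0// exprn_ge0.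
Unshelve. all: by end_near. Qed.

(** * The matrix exponential and its fixed vectors *)

Lemma mexp_entry_cvg (R : realType) d (A : 'M[Cplx R]_d) i j :
  series (fun k => (k`!%:R)^-1 * (A ^+ k) i j) @ \oo --> mexp A i j.
Proof.
pose e i j := series (fun k => (k`!%:R)^-1 * (A ^+ k) i j).
have ce i' j' : cvgn (e i' j').
  apply: (@cvgn_exp_series _ _ (mx_norm1 A)); first exact: mx_norm1_ge0.
  by move=> n; exact: expmx_entry_le.
suff -> : mexp A = \matrix_(i, j) limn (e i j) by rewrite mxE; exact: ce.
apply: cvg_lim; first exact: mx_hausdorff.
apply: cvg_mx => i' j'; rewrite mxE.
rewrite (_ : (fun k => _) = e i' j'); first exact: ce.
apply/funext => n; rewrite /e /series/= summxE.
by apply: eq_bigr => k _; rewrite mxE.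
Qed.

Lemma mexp_mulmx_cvg (R : realType) d p
    (A : 'M[Cplx R]_d) (u : 'M[Cplx R]_(d, p)) i j :
  series (fun k => (k`!%:R)^-1 * (A ^+ k *m u) i j) @ \oo --> (mexp A *m u) i j.
Proof.
rewrite mxE.
rewrite (_ : series _ = fun n =>
    \sum_l series (fun k => (k`!%:R)^-1 * (A ^+ k) i l) n * u l j); last first.
  apply/funext => n; rewrite /series/=.
  under [RHS]eq_bigr do rewrite mulr_suml.
  rewrite exchange_big/=; apply: eq_bigr => k _.
  by rewrite mxE mulr_sumr; apply: eq_bigr => l _; rewrite mulrA.
apply: cvg_big => [|l _]; first exact: add_continuous.
by apply: cvgMr_tmp; exact: mexp_entry_cvg.
Qed.

(** Only the term of index 0 survives, so the partial sums are constant from n = 1 on. *)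
Lemma mexp_fix_ker (R : realType) d p (A : 'M[Cplx R]_d) (u : 'M[Cplx R]_(d, p)) :
  A *m u = 0 -> mexp A *m u = u.
Proof.
move=> Au; apply/matrixP => i j.
apply: (@cvg_unique (Cplx R) _ _ _ _ _ (@mexp_mulmx_cvg _ _ _ A u i j)).
  exact: norm_hausdorff.
apply: cvg_near_cst; near=> n.
have /prednK <- : (0 < n)%N by near: n; exact: nbhs_infty_gt.
rewrite /series/= big_nat_recl// big1_seq ?addr0.
  by rewrite expr0 fact0 invr1 mul1r mul1mx.
by move=> k _; rewrite exprSr -mulmxA Au mulmx0 mxE mulr0.
Unshelve. all: by end_near. Qed.

Lemma exprZmx (K : comNzRingType) n (c : K) (A : 'M[K]_n) k :
  (c *: A) ^+ k = c ^+ k *: A ^+ k.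
Proof.
elim: k => [|k IH]; first by rewrite !expr0 scale1r.
by rewrite !exprS IH -!mulmxE -scalemxAl -scalemxAr scalerA.
Qed.

Lemma mexp0 (R : realType) d : mexp (0 : 'M[Cplx R]_d) = 1%:M.
Proof. by rewrite -[LHS]mulmx1 mexp_fix_ker// mul0mx. Qed.

(** At a nonzero entry i of J u, the fixed-point equation cancels u and leaves |z| |(J u)_i| <= 2 U
    K^2 |z|^2; dividing by |z| bounds |z| from below. *)
Lemma mexp_fix_isolated (R : realType) d (J : 'M[Cplx R]_d) (u : 'cV[Cplx R]_d) :
    J *m u != 0 ->
  exists2 r : Cplx R, 0 < r &
    forall z, `|z| < r -> mexp (z *: J) *m u = u -> z = 0.
Proof.
move=> Ju; have [i Jui] : exists i, (J *m u) i 0 != 0.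
  apply/existsP; apply: contraNT Ju; rewrite negb_exists => /forallP h.
  apply/eqP/matrixP => i j; rewrite ord1 [RHS]mxE; apply/eqP.
  by have := h i; rewrite negbK.
pose U := mx_norm1 u; pose K := mx_norm1 J.
have aU k : `|(J ^+ k *m u) i 0| <= U * K ^+ k.
  by rewrite mulrC; apply: mulmx_entry_le => *; exact: expmx_entry_le.
have e0 : 0 < `|(J *m u) i 0| by rewrite normr_gt0.
have eUK : `|(J *m u) i 0| <= U * K by have := aU 1%N; rewrite !expr1.
have UK0 : 0 < U * K := lt_le_trans e0 eUK.
have K0 : 0 < K.
  rewrite lt_def mx_norm1_ge0 andbT.
  by apply: contraTneq UK0 => ->; rewrite mulr0 ltxx.
have D0 : 0 < 2 * (U * K) * K by apply: mulr_gt0 K0; exact: mulr_gt0 UK0.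
exists (`|(J *m u) i 0| / (2 * (U * K) * K)); first by rewrite divr_gt0.
move=> z zr fz; have [//|z0] := eqVneq z 0.
(* The same radius gives the smallness needed for the remainder bound, since |(J u)_i| <= U K. *)
have q2 : K * `|z| <= 2^-1.
  move: zr; rewrite ltr_pdivlMr// => zr.
  have D1 : 0 < 2 * (U * K) by exact: mulr_gt0 UK0.
  rewrite -(ler_pM2r D1) mulKf ?pnatr_eq0//; apply: le_trans eUK.
  have -> : K * `|z| * (2 * (U * K)) = `|z| * (2 * (U * K) * K) by ring.
  exact: ltW.
have pE k : ((z *: J) ^+ k *m u) i 0 = z ^+ k * (J ^+ k *m u) i 0.
  by rewrite exprZmx -scalemxAl mxE.
have := @exp_series_quadratic _ (fun k => ((z *: J) ^+ k *m u) i 0) U (K * `|z|)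
  ((mexp (z *: J) *m u) i 0) _ q2 _ (@mexp_mulmx_cvg _ _ _ (z *: J) u i 0).
rewrite fz !pE !expr0 !expr1 !mul1r mul1mx opprD addrA subrr add0r normrN normrM.
have q0 : 0 <= K * `|z| by rewrite mulr_ge0// ltW.
move=> /(_ q0) H; have {}H : `|z| * `|(J *m u) i 0| <= 2 * U * (K * `|z|) ^+ 2.
  apply: H => k; rewrite pE normrM normrX exprMn mulrA [leRHS]mulrC.
  by rewrite ler_wpM2l ?exprn_ge0 ?normr_ge0 ?aU.
suff : `|(J *m u) i 0| <= `|z| * (2 * (U * K) * K).
  by rewrite -ler_pdivrMr// => /le_lt_trans /(_ zr); rewrite ltxx.
have z0' : 0 < `|z| by rewrite normr_gt0.
rewrite -(ler_pM2l z0'); apply: le_trans H _.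
have -> : 2 * U * (K * `|z|) ^+ 2 = `|z| * (`|z| * (2 * (U * K) * K)) by ring.
exact: lexx.
Qed.

(** * The exponential map and the centers *)

(** The hypothesis covers both cases used later: v in ker J with t arbitrary, and t = 0 with v
    arbitrary. *)
Lemma grp_exp_fix (R : realType) d (J : 'M[Cplx R]_d) (x : 'cV[Cplx R]_d * Cplx R) :
  x.2 *: (J *m x.1) = 0 -> grp_exp J x = x.
Proof.
case: x => v t /= Jv; rewrite /grp_exp/=; congr (_, _).
apply: (@cvg_lim 'cV[Cplx R]_d (@mx_hausdorff _ _ _)).
apply: cvg_near_cst; near=> n.
have /prednK <- : (0 < n)%N by near: n; exact: nbhs_infty_gt.
rewrite /series/= big_nat_recl// big1_seq ?addr0.
  by rewrite expr0 invr1 scale1r mul1mx.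
by move=> k _; rewrite exprSr -mulmxA -scalemxAl Jv mulmx0 scaler0.
Unshelve. all: by end_near. Qed.

Lemma lie_centerE (R : realType) d (J : 'M[Cplx R]_d) : J != 0 ->
  lie_center J = [set x | J *m x.1 = 0 /\ x.2 = 0].
Proof.
move=> J0; apply/seteqP; split=> -[v t] /=; last first.
  by move=> [Jv t0] [u s]; rewrite /lie_bracket/= Jv t0 scale0r scaler0 subrr.
move=> vt; split.
  have [] := vt (0, 1); rewrite mulmx0 scaler0 scale1r sub0r.
  by move/eqP; rewrite oppr_eq0 => /eqP.
apply/eqP; apply: contraNT J0 => t0; apply/eqP/matrixP => i j.
(* Bracketing with the j-th basis vector gives t times column j of J. *)
have [/matrixP/(_ i 0)] := vt (delta_mx j 0, 0).
rewrite /= scale0r subr0 -colE !mxE => /eqP.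
by rewrite mulf_eq0 (negPf t0) => /eqP.
Qed.

Lemma grp_centerE (R : realType) d (J : 'M[Cplx R]_d) :
  grp_center J = [set g | J *m g.1 = 0 /\ mexp (g.2 *: J) = 1%:M].
Proof.
apply/seteqP; split=> -[v t] /=; last first.
  move=> [Jv tJ] [u s]; rewrite /grp_mul/= tJ mul1mx mexp_fix_ker.
    by rewrite addrC [t + s]addrC.
  by rewrite -scalemxAl Jv scaler0.
move=> vt; split; last first.
  rewrite -[LHS]mulmx1; apply/matrixP => i j.
  (* Commuting with the j-th basis vector says that e^(tJ) fixes it, which determines column j. *)
  have [/=] := vt (delta_mx j 0, 0).
  rewrite scale0r mexp0 mul1mx addrC => /addIr /matrixP/(_ i 0).
  by rewrite -colE mulmx1 !mxE eqxx andbT.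
apply/eqP; apply: contrapT => /negP /mexp_fix_isolated[r r0 rJ].
have [z z0 zr] : exists2 z : Cplx R, z != 0 & `|z| < r.
  exists (r / 2); first by rewrite mulf_neq0// gt_eqF.
  by rewrite gtr0_norm ?divr_gt0// ltr_pdivrMr// ltr_pMr// ltr1n.
apply: (negP z0); apply/eqP/(rJ z zr).
have [/= + _] := vt (0, z).
(* Rewriting with [mexp] visible makes unification unfold the limits. *)
move: (mexp (z *: J)) (mexp (t *: J)) => P Q.
by rewrite mulmx0 addr0 add0r => <-.
Qed.

Lemma grp_center0E (R : realType) d (J : 'M[Cplx R]_d) : J != 0 ->
  grp_center0 J = [set g | J *m g.1 = 0 /\ g.2 = 0].
Proof.
move=> J0; apply/seteqP; split=> [g [B [B0 BZ cB] Bg]|[v t]]/=; last first.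
  move=> [Jv ->].
  (* The segment from the identity to (v, 0) stays in the center. *)
  pose f (s : R) : 'cV[Cplx R]_d * Cplx R := ((s%:C)%C *: v, 0).
  exists (f @` `[0, 1]); last first.
    by exists 1; [rewrite /= in_itv/= ler01 lexx|rewrite /f scale1r].
  split.
  - by exists 0; [rewrite /= in_itv/= ler01 lexx|rewrite /f scale0r].
  - rewrite grp_centerE => _ [s _ <-]/=.
    by rewrite -scalemxAr Jv scaler0 scale0r mexp0.
  apply: connected_continuous_connected; first exact: segment_connected.
  apply: continuous_subspaceT => s.
  suff sv : ((s'%:C)%C : Cplx R) *: v @[s' --> s] --> ((s%:C)%C : Cplx R) *: v.
    exact: (cvg_pair sv (cvg_cst _)).
  apply: cvg_mx => i j; rewrite mxE; under eq_fun do rewrite mxE.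
  by apply: cvgMr_tmp; exact: real_complex_continuous.
rewrite grp_centerE in BZ.
have [u Ju] : exists u : 'cV_d, J *m u != 0.
  apply: contrapT => /forallNP Ju; move/eqP: J0; apply; apply/matrixP => i j.
  have /negP/negPn/eqP/matrixP/(_ i 0) := Ju (delta_mx j 0).
  by rewrite -colE !mxE.
have [r r0 rJ] := mexp_fix_isolated Ju.
have [Jg _] := BZ _ Bg; split => //.
(* The left side is closed in B and the right side open in B; B being connected and containing the
   identity, both are all of B. *)
have BE : B `&` [set h | h.2 = 0] = B `&` [set h | `|h.2| < r].
  apply/seteqP; split=> h [Bh /= h2]; split=> //=; first by rewrite h2 normr0.
  by have [_ hJ] := BZ _ Bh; apply: rJ; rewrite ?hJ ?mul1mx.
suff BB : B `&` [set h | h.2 = 0] = B by move: Bg; rewrite -BB => -[].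
apply: cB.
- by exists (0, 0).
- exists [set h | `|h.2| < r] => //.
  rewrite (_ : [set h | _] = snd @^-1` ball (0 : Cplx R) r).
    by apply: open_comp; [move=> ? _; exact: cvg_snd|exact: ball_open].
  by apply/seteqP; split=> h; rewrite /= -ball_normE/= sub0r normrN.
- exists [set h | h.2 = 0] => //.
  apply: (@preimage_closed _ _ snd [set 0]); first by move=> ? _; exact: cvg_snd.
  apply: accessible_closed_set1; apply: hausdorff_accessible.
  exact: norm_hausdorff.
Qed.

Theorem proposition4p2 (R : realType) (aleph : multiplicity R)
    (aleph_aa : almost_abelian (jordan_mx aleph)) :
  let J := jordan_mx aleph in
  [/\ grp_center J =
        [set g | (grp_exp J @` lie_center J) (g.1, 0) /\ exp_period J g.2],
      [set g | (grp_exp J @` lie_center J) (g.1, 0) /\ exp_period J g.2] =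
        grp_exp J @` [set x | lie_center J (x.1, 0) /\ exp_period J x.2],
      grp_exp J @` [set x | lie_center J (x.1, 0) /\ exp_period J x.2] =
        [set g | J *m g.1 = 0 /\ mexp (g.2 *: J) = 1%:M]
    & grp_exp J @^-1` (grp_center0 J) = lie_center J].
Proof.
move=> J.
have J0 : J != 0.
  have [[x [y xy]] _] := aleph_aa; apply: contraNneq xy => J0.
  by rewrite /lie_bracket -/J J0 !mul0mx !scaler0 subrr.
(* Both product descriptions reduce to the explicit set because [grp_exp] is the identity on ker J x
   C. *)
have e2 : [set g | (grp_exp J @` lie_center J) (g.1, 0) /\ exp_period J g.2] =
    [set g | J *m g.1 = 0 /\ mexp (g.2 *: J) = 1%:M].
  rewrite lie_centerE//; apply/seteqP; split=> -[v t] [] /=.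
    by move=> [[u s] /= [Ju ->]]; rewrite grp_exp_fix/= ?Ju ?scaler0// => -[<-].
  by move=> Jv tJ; split=> //; exists (v, 0) => //;
    rewrite grp_exp_fix/= ?Jv ?scaler0.
have e3 : grp_exp J @` [set x | lie_center J (x.1, 0) /\ exp_period J x.2] =
    [set g | J *m g.1 = 0 /\ mexp (g.2 *: J) = 1%:M].
  rewrite lie_centerE//; apply/seteqP; split=> [_ [x [[/= Jx _] xJ] <-]|x [Jx xJ]].
    by rewrite grp_exp_fix ?Jx ?scaler0.
  by exists x => //; rewrite grp_exp_fix// Jx scaler0.
split; rewrite ?e2 ?e3 ?grp_centerE//.
rewrite grp_center0E// lie_centerE//; apply/seteqP.
split=> [[v t] [Jv t0]|[v t] [/= Jv t0]].
  (* [grp_exp] keeps the second coordinate, so t = 0 holds before exponentiating, and [grp_exp] then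
     fixes (v, 0). *)
  have {}t0 : t = 0 := t0.
  by move: Jv; rewrite grp_exp_fix t0//= scale0r.
have E : grp_exp J (v, t) = (v, t) by rewrite grp_exp_fix//= Jv scaler0.
suff : [set g | J *m g.1 = 0 /\ g.2 = 0] (grp_exp J (v, t)) by [].
by rewrite E.
Qed.
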